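(* Let $(a,b)$ be an admissible pair, and let $S_{a,b}$ be the sequence of leading digits of $a^n$ in base $b$. Then the cyclomatic complexity $C_{a,b}$ of $S_{a,b}$ is given by $$C_{a,b}=b-\left\lfloor\frac{b-1}{r}\right\rfloor-\left\lfloor\frac{\gcd(b,r)-1}{s}\right\rfloor,$$ where $r$ and $s$ are the unique integers satisfying $$a=\frac{r}{s}\,b^k,\quad k\in\mathbb{Z},\quad r,s\in\mathbb{N},\quad \gcd(r,s)=1,\quad 1<\frac{r}{s}<b.$$
   Context: For an integer $b\ge 3$ and a real $x>0$, the leading digit $D_b(x)\in\{1,2,\dots,b-1\}$ of $x$ in base $b$ is defined by: $D_b(x)=d$ if and only if $d\cdot b^j\le x<(d+1)b^j$ for some $j\in\mathbb{Z}$. For real $a>0$, the leading digit sequence is $S_{a,b}=\{D_b(a^n)\}_{n=1}^\infty$. A pair $(a,b)$ is called admissible if (i) $b$ is a squarefree integer $\ge 5$, and (ii) $a$ is a positive rational number that is not an integral power of $b$ (i.e., $a\ne b^h$ for every $h\in\mathbb{Z}$). The cyclomatic complexity of a finite directed graph $G$ is $C_G=e-n+p$, where $e$ is the number of directed edges, $n$ the number of vertices, and $p$ the number of connected components of $G$. The transition graph of an infinite sequence $S$ over a finite set of symbols is the directed graph whose vertices are the symbols occurring in $S$, with an edge from $x$ to $y$ (loops $x=y$ allowed) if and only if $x$ and $y$ occur, in this order, in consecutive positions of $S$. The cyclomatic complexity $C_S$ of $S$ is the cyclomatic complexity of its transition graph; $C_{a,b}$ denotes $C_S$ for $S=S_{a,b}$.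 *)

(* Defs.v *)
(* Mathematical Components, with classical reasoning from mathcomp.classical. *)
From mathcomp Require Import all_boot all_order all_algebra.
From mathcomp Require Import boolp.

Set Implicit Arguments.
Unset Strict Implicit.
Unset Printing Implicit Defensive.

Import Order.TTheory GRing.Theory Num.Theory.
Local Open Scope ring_scope.

(* The field is kept generic so that the definition covers any archimedean
   field of reals, in particular the reals and the rationals. *)
Definition is_leading_digit (R : archiRealFieldType) (b : nat) (x : R)
    (d : nat) : Prop :=
  (0 < d < b)%N /\
  exists j : int, d%:R * b%:R ^ j <= x < d.+1%:R * b%:R ^ j.

(* For 2 <= b and 0 < x exactly one d satisfies [is_leading_digit b x d];
   the default value 0, which is not a digit, is not reached. *)
Definition leading_digit (R : archiRealFieldType) (b : nat) (x : R) : 'I_b.+1 :=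
  odflt ord0 [pick d : 'I_b.+1 | `[< is_leading_digit b x d >]].

(* The sequence D_b(a^1), D_b(a^2), ...: the term at index n is D_b(a^(n+1)). *)
Definition leading_digit_seq (R : archiRealFieldType) (a : R) (b : nat) :
    nat -> 'I_b.+1 :=
  fun n => leading_digit b (a ^+ n.+1).

Record digraph (T : finType) := Digraph {
  vertices : {set T};
  edges : {set T * T};
  edges_sub : edges \subset setX vertices vertices
}.

(* Connected components of a directed graph ignore the edge orientations. *)
Definition adjacent (T : finType) (G : digraph T) : rel T :=
  fun x y => ((x, y) \in edges G) || ((y, x) \in edges G).

Definition num_components (T : finType) (G : digraph T) : nat :=
  n_comp (adjacent G) (vertices G).

Definition cyclomatic_complexity (T : finType) (G : digraph T) : int :=
  #|edges G|%:Z - #|vertices G|%:Z + (num_components G)%:Z.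

Definition transition_vertices (T : finType) (S : nat -> T) : {set T} :=
  [set x | `[< exists n, S n = x >]].

Definition transition_edges (T : finType) (S : nat -> T) : {set T * T} :=
  [set xy | `[< exists n, S n = xy.1 /\ S n.+1 = xy.2 >]].

Lemma transition_edges_sub (T : finType) (S : nat -> T) :
  transition_edges S \subset
    setX (transition_vertices S) (transition_vertices S).
Proof.
apply/subsetP => -[x y]; rewrite !inE /= => /asboolP[n [Sx Sy]].
by apply/andP; split; apply/asboolP; [exists n | exists n.+1].
Qed.

Definition transition_graph (T : finType) (S : nat -> T) : digraph T :=
  Digraph (transition_edges_sub S).

Definition seq_cyclomatic_complexity (T : finType) (S : nat -> T) : int :=
  cyclomatic_complexity (transition_graph S).

Definition squarefree (n : nat) : Prop :=
  forall d : nat, (d ^ 2 %| n)%N -> d = 1%N.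

Definition admissible (a : rat) (b : nat) : Prop :=
  [/\ squarefree b, (5 <= b)%N, 0 < a & forall h : int, a <> b%:R ^ h].

Definition reduced_form (a : rat) (b r s : nat) : Prop :=
  [/\ [/\ (0 < r)%N, (0 < s)%N & coprime r s],
      1 < r%:R / s%:R :> rat, r%:R / s%:R < b%:R :> rat
    & exists k : int, a = r%:R / s%:R * b%:R ^ k].

(* Main.v *)
Require Import Defs.
From mathcomp Require Import all_boot all_order all_algebra.
From mathcomp Require Import boolp.
From mathcomp Require Import ring zify.
Set Implicit Arguments.
Unset Strict Implicit.
Unset Printing Implicit Defensive.
Import Order.TTheory GRing.Theory Num.Theory.
Local Open Scope ring_scope.

(** Write D for the leading digit in base b, which is unchanged when its
    argument is multiplied by a power of b.

    The powers of a are dense among the positive numbers up to multiplication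
    by powers of b ([powers_dense]).  Squarefreeness enters only here: a prime p
    dividing b divides it exactly once, so in a relation a^m = b^l the p-adic
    valuation shows that m divides l, and a would be an integral power of b
    ([squarefree_independent]).  A set of the form {x | D x = d, D (a x) = e} is
    a union of half-open intervals, so once it is nonempty it has interior and
    contains some a^n b^l with n > 0.  Hence every digit is a vertex, and (d, e)
    is an edge as soon as some x > 0 satisfies D x = d and D (a x) = e.

    Let x be such a witness and lower it until either x or a x, taken up to
    powers of b, hits the left end d or e of its digit interval.  This shows
    that every edge is of the form (d, D (a d)) or (D (e / a), e).  Each family
    has b - 1 members.  An edge lies in both families exactly when a d and e
    agree up to a power of b: otherwise the windows of d and e would overlap in
    two different places, which needs (1 + 1/d) (1 + 1/e) > b and is impossible
    for b >= 4 ([successor_predecessor_edgesI]).  The graph of a sequence is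
    connected, so its complexity is 2 (b - 1) - c - (b - 1) + 1 = b - c, where c
    counts the digits d for which a d is a digit times a power of b
    ([leading_digit_seq_cyclomatic]).

    For a = (r / s) b^k this says r d = s e or r d = s e b for some digit e.
    The solutions d of the first equation are the multiples s m with r m < b,
    and those of the second are the multiples s (b / g) m with s m < g, where
    g = gcd(b, r); the two kinds are disjoint because s e < s f b for digits e
    and f ([card_aligned_digits]). *)

(** * Powers in an archimedean field *)

Lemma Posz_succ (n : nat) : n%:Z + 1 = n.+1%:Z.
Proof. by rewrite -PoszD addn1. Qed.

Lemma bernoulli_exprn (R : numDomainType) (q : R) (n : nat) :
  1 <= q -> 1 + (q - 1) *+ n <= q ^+ n.
Proof.
move=> q1; have q0 : 0 <= q - 1 by rewrite subr_ge0.
elim: n => [|n IHn]; first by rewrite mulr0n addr0.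
rewrite exprS mulrS; apply: le_trans (ler_wpM2l (le_trans ler01 q1) IHn).
rewrite -subr_ge0.
have -> : q * (1 + (q - 1) *+ n) - (1 + (q - 1 + (q - 1) *+ n)) =
          (q - 1) * ((q - 1) *+ n) by ring.
by rewrite mulr_ge0 ?mulrn_wge0.
Qed.

Lemma exprn_unbounded (R : archiRealFieldType) (q x : R) :
  1 < q -> exists n : nat, x < q ^+ n.
Proof.
move=> q1; have q0 : 0 < q - 1 by rewrite subr_gt0.
exists (Num.truncn (x / (q - 1))).+1.
apply: lt_le_trans (bernoulli_exprn _ (ltW q1)).
rewrite -mulr_natr; apply: lt_trans (_ : _ < _) (ltr_pwDl ltr01 (lexx _)).
by rewrite mulrC -ltr_pdivrMr // truncnS_gt.
Qed.

Lemma exprz_itv (R : archiRealFieldType) (q x : R) :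
  1 < q -> 0 < x -> exists k : int, q ^ k <= x < q ^ (k + 1).
Proof.
move=> q1 x0; have q0 : 0 < q := lt_trans ltr01 q1.
have [M xM] := exprn_unbounded x^-1 q1.
have y1 : 1 <= x * q ^+ M by rewrite mulrC -ler_pdivrMr // mul1r ltW.
have ex_n : exists n, x * q ^+ M < q ^+ n := exprn_unbounded _ q1.
case: (ex_minnP ex_n) => -[|n]; first by rewrite expr0 ltNge y1.
move=> ltn minn; exists (n%:Z - M%:Z).
have len : q ^+ n <= x * q ^+ M.
  by rewrite leNgt; apply/negP => /minn; rewrite ltnn.
rewrite addrAC Posz_succ.
rewrite !expfzDr ?gt_eqF // -exprnN.
by rewrite ler_pdivrMr ?ltr_pdivlMr ?exprn_gt0 // len.
Qed.

Lemma exprz_itv_uniq (R : realFieldType) (q x : R) (j k : int) :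
  1 < q -> q ^ j <= x < q ^ (j + 1) -> q ^ k <= x < q ^ (k + 1) -> j = k.
Proof.
move=> q1 /andP[lej ltj] /andP[lek ltk].
have := le_lt_trans lej ltk; have := le_lt_trans lek ltj.
rewrite !ltr_eXz2l // !ltzD1 => le1 le2.
by apply/eqP; rewrite eq_le le1 le2.
Qed.

Lemma pigeonhole_ord (K : nat) (f : nat -> 'I_K) :
  exists m n : nat, (m < n)%N /\ f m = f n.
Proof.
have /injectivePn[i [j neq_ij eq_f]] : ~~ injectiveb (fun i : 'I_K.+1 => f i).
  apply/negP => /injectiveP /leq_card; rewrite !card_ord ltnn //.
case: (ltngtP i j) => [lt|lt|/val_inj eq_ij].
- by exists i, j.
- by exists j, i.
- by rewrite eq_ij eqxx in neq_ij.
Qed.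

(** * Density of the powers of a up to powers of c *)

(** Multiply a^0, ..., a^K by powers of c to bring them into [1, c), and cut
    this interval into the K cells [q^k, q^(k+1)): two of these K + 1 numbers
    share a cell, and their quotient is the desired step. *)
Lemma small_multiplicative_step (R : archiRealFieldType) (a c q : R) :
  0 < a -> 1 < c -> 1 < q ->
  exists (m : nat) (l : int), [/\ (0 < m)%N, q^-1 < a ^+ m * c ^ l
    & a ^+ m * c ^ l < q].
Proof.
move=> a0 c1 q1; have c0 : 0 < c := lt_trans ltr01 c1.
have q0 : 0 < q := lt_trans ltr01 q1.
have [K cK] := exprn_unbounded c q1.
have cellP (n : nat) : exists k : 'I_K, exists j : int,
    q ^+ k <= a ^+ n * c ^ j < q ^+ k.+1.
  have [j /andP[lej ltj]] := exprz_itv c1 (exprn_gt0 n a0).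
  have cj0 : 0 < c ^ j by rewrite exprz_gt0.
  have y1 : 1 <= a ^+ n * c ^ (- j).
    by rewrite -invr_expz ler_pdivlMr // mul1r.
  have yc : a ^+ n * c ^ (- j) < c.
    by rewrite -invr_expz ltr_pdivrMr // -[X in X * _]expr1z -expfzDr ?gt_eqF // addrC.
  have [k /andP[lek ltk]] := exprz_itv q1 (lt_le_trans ltr01 y1).
  have k0 : 0 <= k.
    by have := le_lt_trans y1 ltk; rewrite -{1}(expr0z q) ltr_eXz2l // ltzD1.
  case: k k0 lek ltk => // k _ lek ltk.
  have kK : (k < K)%N.
    have := lt_trans (le_lt_trans lek yc) cK.
    by rewrite -exprnP ltr_eXn2l.
  exists (Ordinal kK), (- j); rewrite /= lek /=.
  by move: ltk; rewrite Posz_succ.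
have [f fP] := choice cellP; have [g gP] := choice fP.
have [m [n [ltmn eqf]]] := pigeonhole_ord f.
exists (n - m)%N, (g n - g m); rewrite subn_gt0 ltmn.
have -> : a ^+ (n - m) * c ^ (g n - g m) =
          (a ^+ n * c ^ g n) / (a ^+ m * c ^ g m).
  rewrite expfB // expfzDr ?gt_eqF // -invr_expz; field.
  by rewrite !expfz_neq0 ?expf_neq0 ?gt_eqF.
have /andP[lem ltm] := gP m; have /andP[len ltn] := gP n.
have ym0 : 0 < a ^+ m * c ^ g m by rewrite mulr_gt0 ?exprn_gt0 ?exprz_gt0.
rewrite -eqf in len ltn; rewrite exprS in ltm; rewrite exprS in ltn.
split=> //.
- rewrite ltr_pdivlMr // ltr_pdivrMl //; apply: lt_le_trans ltm _.
  by rewrite ler_pM2l.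
- rewrite ltr_pdivrMr //; apply: lt_le_trans ltn _.
  by rewrite ler_pM2l.
Qed.

(** Relations with m < 0 are the inverses of these, and a relation with m = 0
    would only concern c. *)
Definition multiplicatively_independent (R : fieldType) (a c : R) : Prop :=
  forall (m : nat) (l : int), (0 < m)%N -> a ^+ m * c ^ l <> 1.

(** The powers of a step s with |log s| < log (v / u) cannot jump over the
    interval (u, v).  Since the exponent of a has to remain positive only
    positive powers of s are available, so the walk starts at a power of c below
    u when s > 1 and at a power of c above v when s < 1. *)
Lemma powers_dense (R : archiRealFieldType) (a c u v : R) :
  0 < a -> 1 < c -> multiplicatively_independent a c -> 0 < u -> u < v ->
  exists (n : nat) (l : int), u < a ^+ n.+1 * c ^ l < v.
Proof.
move=> a0 c1 indep u0 uv; have c0 : 0 < c := lt_trans ltr01 c1.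
have v0 := lt_trans u0 uv.
have vu1 : 1 < v / u by rewrite ltr_pdivlMr // mul1r.
have [m [l [m0 gt_step lt_step]]] := small_multiplicative_step a0 c1 vu1.
set s := a ^+ m * c ^ l in gt_step lt_step.
have s0 : 0 < s by rewrite mulr_gt0 ?exprn_gt0 ?exprz_gt0.
have powE (i : nat) (L : int) :
    exists n j, c ^ L * s ^+ i.+1 = a ^+ n.+1 * c ^ j.
  exists (m * i.+1).-1, (L + l * i.+1); rewrite prednK ?muln_gt0 ?m0 //.
  by rewrite exprMn exprM expfzDr ?gt_eqF // -exprz_exp mulrCA.
have [s_lt1|s_gt1|s1] := ltrgtP s 1; last by case: (indep m l m0).
(* The last i with c^L s^i still at least v comes just before the wanted one. *)
- have [L vL] := exprn_unbounded v c1.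
  have w1 : 1 < c ^+ L / v by rewrite ltr_pdivlMr // mul1r.
  have si1 : 1 < s^-1 by rewrite invf_gt1.
  have [i /andP[lei lti]] := exprz_itv si1 (lt_trans ltr01 w1).
  have i0 : 0 <= i.
    by have := lt_trans w1 lti; rewrite -{1}(expr0z s^-1) ltr_eXz2l // ltzD1.
  case: i i0 lei lti => // i _ lei lti.
  have [n [j eq]] := powE i L; exists n, j; rewrite -eq -exprnP.
  move: lei lti; rewrite Posz_succ.
  rewrite -!exprnP !exprVn => lei lti.
  have si0 k : 0 < s ^+ k by rewrite exprn_gt0.
  apply/andP; split; last first.
    by move: lti; rewrite ltr_pdivrMr // mulrC ltr_pdivlMr.
  move: lei; rewrite ler_pdivlMr // mulrC ler_pdivrMr // exprSr mulrA => lei.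
  apply: lt_le_trans (_ : v * s <= _); last by rewrite ler_pM2r.
  by move: gt_step; rewrite invf_div ltr_pdivrMr // mulrC.
- have [L /andP[Lu _]] := exprz_itv c1 u0.
  have cL0 : 0 < c ^ L by rewrite exprz_gt0.
  have w1 : 1 <= u / c ^ L by rewrite ler_pdivlMr // mul1r.
  have [i /andP[lei lti]] := exprz_itv s_gt1 (lt_le_trans ltr01 w1).
  have i0 : 0 <= i.
    by have := le_lt_trans w1 lti; rewrite -{1}(expr0z s) ltr_eXz2l // ltzD1.
  case: i i0 lei lti => // i _ lei lti.
  have [n [j eq]] := powE i L; exists n, j; rewrite -eq.
  move: lei lti; rewrite Posz_succ.
  rewrite -!exprnP ler_pdivlMr // ltr_pdivrMr // => lei lti.
  rewrite mulrC lti /= exprS -mulrA.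
  apply: le_lt_trans (_ : s * u < _); first by rewrite ler_pM2l.
  by rewrite -ltr_pdivlMr.
Qed.

(** * Multiplicative independence of a rational and a squarefree base *)

Lemma squarefree_logn_pdiv (b : nat) :
  squarefree b -> (1 < b)%N -> logn (pdiv b) b = 1%N.
Proof.
move=> sqf b1; have pr := pdiv_prime b1; have b0 : (0 < b)%N by lia.
apply/eqP; rewrite eqn_leq -!(pfactor_dvdn _ pr) // expn1 pdiv_dvd andbT.
rewrite leqNgt -pfactor_dvdn //; apply/negP => /sqf p1.
by rewrite p1 in pr.
Qed.

Lemma pos_rat_fraction (x : rat) : 0 < x ->
  exists p q : nat, [/\ (0 < p)%N, (0 < q)%N, coprime p q & x = p%:R / q%:R].
Proof.
move=> x0; exists `|numq x|%N, `|denq x|%N.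
rewrite !absz_gt0 numq_eq0 gt_eqF // denq_neq0 coprime_num_den; split=> //.
rewrite -[LHS]divq_num_den -[in LHS](gez0_abs (ltW (denq_gt0 x))).
by rewrite -[in LHS](@gez0_abs (numq x)) // ltW // numq_gt0.
Qed.

Lemma coprime_fraction_inj (p q p' q' : nat) : (0 < q)%N -> (0 < q')%N ->
  coprime p q -> coprime p' q' ->
  p%:R / q%:R = p'%:R / q'%:R :> rat -> (p, q) = (p', q').
Proof.
move=> q0 q'0 cop cop' /eqP; rewrite eqr_div ?pnatr_eq0 -?lt0n //.
rewrite -!natrM eqr_nat => /eqP eq.
have eqq : q = q'.
  apply/eqP; rewrite eqn_dvd -(Gauss_dvdr q' (n := p)) 1?coprime_sym //.
  rewrite eq dvdn_mull //= -(Gauss_dvdr q (n := p')) 1?coprime_sym //.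
  by rewrite -eq dvdn_mull.
move/eqP: eq; rewrite eqq eqn_pmul2r // => /eqP ->.
by [].
Qed.

(** At a prime p dividing b exactly once, a relation a^m b^l = 1 reads
    m v_p(a) + l = 0, so that a^m = (b^(v_p(a)))^m and a = b^(v_p(a)). *)
Lemma squarefree_independent (a : rat) (b : nat) :
  squarefree b -> (1 < b)%N -> 0 < a -> (forall h : int, a <> b%:R ^ h) ->
  multiplicatively_independent a b%:R.
Proof.
move=> sqf b1 a0 not_pow m l m0 eq1.
have bn0 : (0 < b)%N by lia.
have b0 : (b%:R : rat) != 0 by rewrite pnatr_eq0; lia.
have [P [Q [P0 Q0 _ aPQ]]] := pos_rat_fraction a0.
have Q0' : (Q%:R : rat) != 0 by rewrite pnatr_eq0; lia.
set p := pdiv b; have pb : logn p b = 1%N by exact: squarefree_logn_pdiv.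
have l_eq : l = m%:Z * ((logn p Q)%:Z - (logn p P)%:Z).
  have Qm0 : (Q%:R : rat) ^+ m != 0 by rewrite expf_neq0.
  case: l eq1 => l; rewrite aPQ expr_div_n => eq1.
    have /(congr1 (logn p)) : (P ^ m * b ^ l = Q ^ m)%N.
      apply/eqP; rewrite -(eqr_nat rat) natrM !natrX; apply/eqP.
      by apply: (divIf Qm0); rewrite divff // -[RHS]eq1 mulrAC.
    by rewrite lognM ?expn_gt0 ?P0 ?bn0 // !lognX pb; lia.
  have bl0 : (b%:R : rat) ^+ l.+1 != 0 by rewrite expf_neq0.
  have /(congr1 (logn p)) : (P ^ m = Q ^ m * b ^ l.+1)%N.
    apply/eqP; rewrite -(eqr_nat rat) natrM !natrX; apply/eqP.
    apply: (divIf Qm0); apply: (divIf bl0).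
    by rewrite NegzE -exprnN in eq1; rewrite eq1 [Q%:R ^+ m * _]mulrC mulfK // divff.
  by rewrite lognM ?expn_gt0 ?Q0 ?bn0 // !lognX pb; lia.
apply: (not_pow ((logn p P)%:Z - (logn p Q)%:Z)).
have bh0 : 0 <= (b%:R : rat) ^ ((logn p P)%:Z - (logn p Q)%:Z).
  by rewrite exprz_ge0.
apply/eqP; rewrite -(@eqrXn2 _ m) // ?ltW //; apply/eqP.
apply: (mulIf (expfz_neq0 l b0)).
rewrite eq1 exprnP exprz_exp -expfzDr // l_eq.
by rewrite (_ : _ + _ = 0) ?expr0z //; ring.
Qed.

(** * Leading digits *)

Lemma is_leading_digit_gt0 (R : archiRealFieldType) (b : nat) (x : R) (d : nat) :
  is_leading_digit b x d -> 0 < x.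
Proof.
case=> /andP[d0 db] [j /andP[le _]]; apply: lt_le_trans le.
by rewrite mulr_gt0 ?exprz_gt0 ?ltr0n //; lia.
Qed.

Lemma is_leading_digit_scale (R : archiRealFieldType) (b : nat) (x : R)
    (d : nat) (l : int) :
  is_leading_digit b x d -> is_leading_digit b (x * b%:R ^ l) d.
Proof.
case=> /andP[d0 db] [j /andP[le lt]]; split; first by rewrite d0.
have b0 : 0 < b%:R :> R by rewrite ltr0n; lia.
exists (j + l); rewrite expfzDr ?gt_eqF // !mulrA.
by rewrite ler_pM2r ?ltr_pM2r ?exprz_gt0 // le.
Qed.

Lemma is_leading_digit_expz (R : archiRealFieldType) (b : nat) (x : R)
    (d : nat) (j : int) : (0 < d < b)%N ->
  d%:R * b%:R ^ j <= x < d.+1%:R * b%:R ^ j ->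
  b%:R ^ j <= x < b%:R ^ (j + 1).
Proof.
move=> /andP[d0 db] /andP[le lt].
have b0 : 0 < b%:R :> R by rewrite ltr0n; lia.
apply/andP; split.
  by apply: le_trans le; rewrite ler_peMl ?exprz_ge0 ?ler1n // ltW.
apply: lt_le_trans lt _; rewrite expfzDr ?gt_eqF // expr1z mulrC.
by rewrite ler_pM2l ?exprz_gt0 // ler_nat.
Qed.

Lemma is_leading_digit_uniq (R : archiRealFieldType) (b : nat) (x : R)
    (d e : nat) :
  is_leading_digit b x d -> is_leading_digit b x e -> d = e.
Proof.
move=> [d_b [i xi]] [e_b [j xj]].
have b1 : 1 < b%:R :> R by rewrite ltr1n; lia.
have ij := exprz_itv_uniq b1 (is_leading_digit_expz d_b xi)
                             (is_leading_digit_expz e_b xj).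
rewrite {}ij in xi.
have bj0 : 0 < b%:R ^ j :> R by rewrite exprz_gt0 // (lt_trans ltr01).
move: xi xj => /andP[le1 lt1] /andP[le2 lt2].
have := le_lt_trans le1 lt2; have := le_lt_trans le2 lt1.
by rewrite !ltr_pM2r // !ltr_nat; lia.
Qed.

Lemma leading_digitP (R : archiRealFieldType) (b : nat) (x : R) :
  (1 < b)%N -> 0 < x -> is_leading_digit b x (leading_digit b x).
Proof.
move=> b1 x0; have b1' : 1 < b%:R :> R by rewrite ltr1n.
have b0 : 0 < b%:R :> R by rewrite ltr0n; lia.
have [j /andP[lej ltj]] := exprz_itv b1' x0.
have bj0 : 0 < b%:R ^ j :> R by rewrite exprz_gt0.
have y1 : 1 <= x / b%:R ^ j by rewrite ler_pdivlMr // mul1r.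
have yb : x / b%:R ^ j < b%:R.
  by rewrite ltr_pdivrMr // -[X in X * _]expr1z -expfzDr ?gt_eqF // addrC.
have y0 := le_trans ler01 y1.
have d_b : (0 < Num.truncn (x / b%:R ^ j) < b)%N.
  by rewrite truncn_gt0 y1 truncn_lt_nat.
have d_ltb : (Num.truncn (x / b%:R ^ j) < b.+1)%N.
  by case/andP: d_b => _; apply: leqW.
have dP : is_leading_digit b x (Ordinal d_ltb).
  split=> //; exists j; have := truncn_itv y0.
  by rewrite ler_pdivlMr // ltr_pdivrMr.
rewrite /leading_digit; case: pickP => [d /asboolP //|none].
by have := none (Ordinal d_ltb); rewrite asboolT.
Qed.

Lemma leading_digit_def (R : archiRealFieldType) (b : nat) (x : R)
    (d : 'I_b.+1) : is_leading_digit b x d -> leading_digit b x = d.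
Proof.
move=> dP; have b1 : (1 < b)%N by case: dP => /andP[d0 db] _; apply: leq_ltn_trans db.
apply/val_inj; apply: (is_leading_digit_uniq _ dP).
exact: leading_digitP b1 (is_leading_digit_gt0 dP).
Qed.

Lemma leading_digitMexpz (R : archiRealFieldType) (b : nat) (x : R) (l : int) :
  (1 < b)%N -> 0 < x -> leading_digit b (x * b%:R ^ l) = leading_digit b x.
Proof.
move=> b1 x0; apply: leading_digit_def; apply: is_leading_digit_scale.
exact: leading_digitP.
Qed.

(** As a subset of the ordinals below b + 1, the type of leading digits, which
    also contains 0 and b. *)
Definition digits (b : nat) : {set 'I_b.+1} := [set d : 'I_b.+1 | 0 < d < b]%N.

Lemma is_leading_digit_nat (R : archiRealFieldType) (b d : nat) :
  (0 < d < b)%N -> is_leading_digit b (d%:R : R) d.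
Proof.
by split=> //; exists 0; rewrite expr0z !mulr1 lexx ltr_nat ltnSn.
Qed.

Lemma leading_digit_in_digits (R : archiRealFieldType) (b : nat) (x : R) :
  (1 < b)%N -> 0 < x -> leading_digit b x \in digits b.
Proof. by move=> b1 x0; rewrite inE; case: (leading_digitP b1 x0). Qed.

Lemma leading_digit_nat (R : archiRealFieldType) (b : nat) (d : 'I_b.+1) :
  d \in digits b -> leading_digit b (d%:R : R) = d.
Proof. by rewrite inE => db; apply/leading_digit_def/is_leading_digit_nat. Qed.

Lemma card_digits (b : nat) : #|digits b| = b.-1.
Proof.
case: b => [|b]; first by apply: eq_card0 => d; rewrite !inE; lia.
have -> : digits b.+1 = ~: [set ord0; ord_max].
  apply/setP => d; rewrite !inE -!val_eqE /=; have := ltn_ord d; lia.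
by rewrite cardsCs setCK card_ord cards2 /=; lia.
Qed.

(** * Transitions between leading digits *)

Section Edges.
Variables (R : archiRealFieldType) (a : R) (b : nat).
Hypotheses (b1 : (1 < b)%N) (a0 : 0 < a).

(** Both digits stay the same on a right neighbourhood of x, because the digit
    intervals contain their left ends; by density that neighbourhood contains a
    positive power of a times a power of b. *)
Lemma leading_digit_seq_realizes (x : R) :
  multiplicatively_independent a b%:R -> 0 < x ->
  exists n, leading_digit_seq a b n = leading_digit b x /\
            leading_digit_seq a b n.+1 = leading_digit b (a * x).
Proof.
move=> indep x0; have ax0 : 0 < a * x by rewrite mulr_gt0.
have b1' : 1 < b%:R :> R by rewrite ltr1n.
have [d_b [i /andP[lei lti]]] := leading_digitP b1 x0.
have [e_b [j /andP[lej ltj]]] := leading_digitP b1 ax0.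
set u := (X in _ < X) in lti; set w := (X in _ < X) in ltj.
have ltx : x < Num.min u (w / a).
  by rewrite lt_min lti ltr_pdivlMr // mulrC.
have [n [l /andP[gtx lt]]] := powers_dense a0 b1' indep x0 ltx.
move: lt; rewrite lt_min => /andP[ltu ltw].
exists n; rewrite /leading_digit_seq; split.
  rewrite -(leading_digitMexpz l b1) ?exprn_gt0 //.
  apply: leading_digit_def; split=> //; exists i.
  by rewrite ltu andbT (le_trans lei) // ltW.
rewrite -(leading_digitMexpz l b1) ?exprn_gt0 // exprS -mulrA.
apply: leading_digit_def; split=> //; exists j.
rewrite (le_trans lej) /=; last by rewrite ler_pM2l // ltW.
by rewrite mulrC -ltr_pdivlMr.
Qed.

(** The transitions whose source is exactly a digit times a power of b. *)
Definition successor_edges : {set 'I_b.+1 * 'I_b.+1} :=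
  [set (d, leading_digit b (a * d%:R)) | d : 'I_b.+1 in digits b].

(** The transitions whose target is exactly a digit times a power of b. *)
Definition predecessor_edges : {set 'I_b.+1 * 'I_b.+1} :=
  [set (leading_digit b (e%:R / a), e) | e : 'I_b.+1 in digits b].

(** Normalise x to d b^i <= x < (d+1) b^i and e b^j <= a x < (e+1) b^j.  The
    least number satisfying all these inequalities is the larger of d b^i and
    e b^j / a; it has the same two digits as x and belongs to the first family
    of edges in one case and to the second in the other. *)
Lemma leading_digit_step (x : R) : 0 < x ->
  (leading_digit b x, leading_digit b (a * x))
    \in successor_edges :|: predecessor_edges.
Proof.
move=> x0; have ax0 : 0 < a * x by rewrite mulr_gt0.
have [d_b [i /andP[lei lti]]] := leading_digitP b1 x0.
have [e_b [j /andP[lej ltj]]] := leading_digitP b1 ax0.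
set d := leading_digit b x in d_b lei lti *.
set e := leading_digit b (a * x) in e_b lej ltj *.
have d0 : 0 < (d : nat)%:R :> R by rewrite ltr0n; lia.
have e0 : 0 < (e : nat)%:R :> R by rewrite ltr0n; lia.
have [le|lt] := lerP (e%:R * b%:R ^ j) (a * (d%:R * b%:R ^ i)).
  apply/setUP; left; apply/imsetP; exists d; rewrite ?inE //.
  congr (_, _); symmetry.
  rewrite -(leading_digitMexpz i b1) ?mulr_gt0 // -mulrA.
  apply: leading_digit_def; split=> //; exists j; rewrite le /=.
  by apply: le_lt_trans ltj; rewrite ler_pM2l.
apply/setUP; right; apply/imsetP; exists e; rewrite ?inE //.
congr (_, _); symmetry.
rewrite -(leading_digitMexpz j b1) ?divr_gt0 //.
apply: leading_digit_def; split=> //; exists i; rewrite mulrAC.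
rewrite ler_pdivlMr // mulrC (ltW lt) /=; apply: le_lt_trans lti.
by rewrite ler_pdivrMr // [x * a]mulrC.
Qed.

Lemma transition_edges_leading_digit_seq :
  multiplicatively_independent a b%:R ->
  transition_edges (leading_digit_seq a b) =
    successor_edges :|: predecessor_edges.
Proof.
move=> indep; apply/setP => -[d e]; apply/idP/idP; rewrite inE.
  move=> /asboolP[n /= [<- <-]]; rewrite /leading_digit_seq [a ^+ n.+2]exprS.
  by apply: leading_digit_step; rewrite exprn_gt0.
move=> /orP[] /imsetP[z]; rewrite inE => zb [-> ->];
  (have z0 : 0 < (z : nat)%:R :> R by rewrite ltr0n; lia);
  rewrite inE; apply/asboolP.
  have [n [n1 n2]] := leading_digit_seq_realizes indep z0.
  by exists n; rewrite n1 n2 leading_digit_nat // inE.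
have [n [n1 n2]] := leading_digit_seq_realizes indep (divr_gt0 z0 a0).
exists n; rewrite n1 n2 /= mulrCA divff ?gt_eqF // mulr1.
by rewrite leading_digit_nat // inE.
Qed.

Lemma transition_vertices_leading_digit_seq :
  multiplicatively_independent a b%:R ->
  transition_vertices (leading_digit_seq a b) = digits b.
Proof.
move=> indep; apply/setP => d; apply/idP/idP; rewrite inE.
  by move=> /asboolP[n <-]; rewrite leading_digit_in_digits ?exprn_gt0.
move=> db; rewrite inE; apply/asboolP.
have d0 : 0 < (d : nat)%:R :> R by rewrite ltr0n; lia.
have [n [n1 _]] := leading_digit_seq_realizes indep d0.
by exists n; rewrite n1 leading_digit_nat // inE.
Qed.

(** The digits that multiplication by a sends to the left end of a digit
    interval. *)
Definition aligned_digits : {set 'I_b.+1} :=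
  [set d in digits b | `[< exists (e : nat) (j : int),
     (0 < e < b)%N /\ a * d%:R = e%:R * b%:R ^ j >]].

(** If (d, e) is in both families, then e b^j <= a d < (e+1) b^j and
    d b^i <= e / a < (d+1) b^i.  The lower bounds give
    e b^j <= a d <= e b^(-i), hence j <= - i, with a d = e b^j when j = - i;
    and j < - i would give
    e b^(j+1) < a (d+1) <= 2 a d < 2 (e+1) b^j <= 4 e b^j, against b >= 4. *)
Lemma successor_predecessor_edgesI : (3 < b)%N ->
  successor_edges :&: predecessor_edges =
    [set (d, leading_digit b (a * d%:R)) | d : 'I_b.+1 in aligned_digits].
Proof.
move=> b3; apply/setP => de; apply/setIP/imsetP; last first.
  move=> [d]; rewrite inE => /andP[db /asboolP[e [j [eb ad]]]] ->.
  split; first by apply/imsetP; exists d.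
  have e_ord : (e < b.+1)%N by lia.
  have De : leading_digit b (a * d%:R) = Ordinal e_ord.
    apply: leading_digit_def; rewrite ad.
    by apply: is_leading_digit_scale; apply: is_leading_digit_nat.
  apply/imsetP; exists (Ordinal e_ord); rewrite ?inE // De; congr (_, _).
  have b0 : b%:R != 0 :> R by rewrite pnatr_eq0; lia.
  have -> : (e%:R / a : R) = d%:R * b%:R ^ (- j).
    rewrite -invr_expz; apply: (mulIf (expfz_neq0 j b0)).
    rewrite divfK ?expfz_neq0 // mulrAC -ad mulrAC divff ?mul1r // gt_eqF //.
  rewrite leading_digitMexpz //; first by rewrite leading_digit_nat.
  by rewrite ltr0n; move: db; rewrite inE; lia.
move=> [/imsetP[d db ->] /imsetP[e eb [dE eE]]].
exists d => //; rewrite inE db; apply/asboolP.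
rewrite !inE in db eb.
have d2 : (d.+1 <= d * 2)%N by clear -db; lia.
have e4 : (e.+1 * 2 <= e * b)%N by clear -eb b3; nia.
have d0 : 0 < (d : nat)%:R :> R by rewrite ltr0n; lia.
have e0 : 0 < (e : nat)%:R :> R by rewrite ltr0n; lia.
have b0 : 0 < b%:R :> R by rewrite ltr0n; lia.
have := leading_digitP b1 (mulr_gt0 a0 d0); rewrite eE => -[_ [j /andP[lej ltj]]].
have := leading_digitP b1 (divr_gt0 e0 a0); rewrite -dE => -[_ [i /andP[lei lti]]].
exists e, j; split=> //; apply/eqP; rewrite eq_le lej andbT.
have bi0 : 0 < b%:R ^ i :> R by rewrite exprz_gt0.
have bj0 : 0 < b%:R ^ j :> R by rewrite exprz_gt0.
rewrite ler_pdivlMr // in lei; rewrite ltr_pdivrMr // in lti.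
have ad_le : a * d%:R <= e%:R * b%:R ^ (- i).
  by rewrite -invr_expz ler_pdivlMr // [a * _]mulrC mulrAC.
have ad_gt : e%:R * b%:R ^ (- i) < a * d.+1%:R.
  by rewrite -invr_expz ltr_pdivrMr // [a * _]mulrC mulrAC.
have [le_ij|] := lerP (- i) j.
  by apply: le_trans ad_le _; rewrite ler_pM2l // ler_eXz2l // ltr1n.
rewrite -lezD1 => lt_ji; exfalso.
have : e%:R * b%:R ^ (j + 1) <= e%:R * b%:R ^ (- i) :> R.
  by rewrite ler_pM2l // ler_eXz2l // ltr1n.
move=> /le_lt_trans /(_ ad_gt); apply/negP; rewrite -leNgt.
apply: le_trans (_ : a * d%:R * 2%:R <= _).
  by rewrite -mulrA ler_pM2l // -natrM ler_nat.
apply: le_trans (_ : e.+1%:R * b%:R ^ j * 2%:R <= _).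
  by rewrite ler_pM2r ?ltr0n // ltW.
rewrite expfzDr ?gt_eqF // expr1z mulrAC [b%:R ^ j * _]mulrC mulrA.
by rewrite ler_pM2r // -!natrM ler_nat.
Qed.
End Edges.

(** * Cyclomatic complexity of the transition graph *)

Lemma num_components_transition_graph (T : finType) (S : nat -> T) :
  num_components (transition_graph S) = 1%N.
Proof.
set G := transition_graph S.
have adj_sym : connect_sym (adjacent G).
  by apply: sym_connect_sym => x y; rewrite /adjacent orbC.
have V_closed : closed (adjacent G) (vertices G).
  by move=> x y /orP[] /(subsetP (edges_sub G)); rewrite inE /= => /andP[-> ->].
have inV n : S n \in vertices G by rewrite inE; apply/asboolP; exists n.
have reach n : connect (adjacent G) (S 0) (S n).
  elim: n => [|n IHn]; first exact: connect0.
  apply: connect_trans IHn (connect1 _); rewrite /adjacent.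
  by apply/orP; left; rewrite inE; apply/asboolP; exists n.
rewrite /num_components -(n_comp_connect adj_sym (S 0)).
apply: eq_n_comp_r => x; apply/idP/idP.
  by rewrite inE => /asboolP[n <-]; apply: reach.
by move=> /(closed_connect V_closed) <-.
Qed.

(** The edges form the union of two families of b - 1 edges each, and the
    aligned digits index the edges common to both. *)
Lemma leading_digit_seq_cyclomatic (R : archiRealFieldType) (a : R) (b : nat) :
  (3 < b)%N -> 0 < a -> multiplicatively_independent a b%:R ->
  seq_cyclomatic_complexity (leading_digit_seq a b) =
    b%:Z - #|aligned_digits a b|%:Z.
Proof.
move=> b3 a0 indep; have b1 : (1 < b)%N by apply: ltn_trans b3.
rewrite /seq_cyclomatic_complexity /cyclomatic_complexity.
rewrite num_components_transition_graph /=.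
rewrite transition_vertices_leading_digit_seq //.
rewrite transition_edges_leading_digit_seq // cardsU.
rewrite successor_predecessor_edgesI // !card_imset;
  try by move=> ? ? [].
have : (#|aligned_digits a b| <= #|digits b|)%N.
  by apply/subset_leq_card/subsetP => d; rewrite inE => /andP[].
rewrite card_digits; move: #|_| => c; clear -b1 => le_c.
lia.
Qed.

Lemma card_multiples (n q N : nat) : (0 < q)%N -> (q * N < n)%N ->
  #|[set d : 'I_n | [&& (0 < d)%N, (q %| d)%N & (d <= q * N)%N]]| = N.
Proof.
move=> q0 ltn.
have lt_ord (i : 'I_N) : (q * i.+1 < n)%N.
  by apply: leq_ltn_trans ltn; rewrite leq_mul2l ltn_ord orbT.
rewrite -[RHS]card_ord -cardsT.
rewrite -(card_imset setT (f := fun i => Ordinal (lt_ord i))); last first.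
  move=> i j [] /eqP; rewrite eqn_pmul2l // eqSS => /eqP eq_ij.
  exact: val_inj.
apply: eq_card => d; apply/idP/imsetP.
  rewrite inE => /and3P[d0 /dvdnP[m dm] le].
  rewrite dm mulnC leq_pmul2l // in le.
  have m0 : (0 < m)%N by case: (m) dm => // dm; rewrite dm in d0.
  have mN : (m.-1 < N)%N by rewrite prednK.
  exists (Ordinal mN) => //; apply/val_inj; rewrite /= prednK // mulnC //.
move=> [i _ ->]; rewrite inE /= muln_gt0 q0 dvdn_mulr //=.
by rewrite leq_mul2l ltn_ord orbT.
Qed.

(** * Counting the aligned digits *)

Section Count.
Variables (b r s : nat) (k : int).
Hypotheses (b1 : (1 < b)%N) (r0 : (0 < r)%N) (s0 : (0 < s)%N).
Hypotheses (cop : coprime r s) (ltsr : (s < r)%N) (ltrb : (r < s * b)%N).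
Let a : rat := r%:R / s%:R * b%:R ^ k.

(** Since r d / s lies strictly between 1 and b^2, while e lies between 1 and b,
    their quotient b^j lies strictly between b^(-1) and b^2. *)
Lemma aligned_exponent (d e : nat) (j : int) :
  (0 < d < b)%N -> (0 < e < b)%N ->
  (r * d)%:R = (s * e)%:R * b%:R ^ j :> rat -> j = 0 \/ j = 1.
Proof.
move=> db eb eq.
have b1' : 1 < b%:R :> rat by rewrite ltr1n.
have b0' : 0 < b%:R :> rat by rewrite ltr0n ltnW.
have se0 : 0 < (s * e)%:R :> rat by rewrite ltr0n muln_gt0 s0; case/andP: eb.
have lo : b%:R ^ (-1) < b%:R ^ j :> rat.
  have : (s * e)%:R * b%:R ^ (-1) < (s * e)%:R * b%:R ^ j :> rat.
    rewrite -eq exprN1 ltr_pdivrMr // -natrM ltr_nat.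
    have [/andP[d0 _] /andP[_ lt_eb]] := (db, eb).
    by apply: ltn_mul lt_eb; apply: leq_trans ltsr _; rewrite leq_pmulr.
  by rewrite ltr_pM2l.
have hi : b%:R ^ j < b%:R ^ 2 :> rat.
  have : (s * e)%:R * b%:R ^ j < (s * e)%:R * b%:R ^ 2 :> rat.
    rewrite -eq -exprnP -natrX -natrM ltr_nat.
    have [/andP[d0 lt_db] /andP[e0 _]] := (db, eb).
    apply: (@ltn_trans (s * b * d)); first by rewrite ltn_pmul2r.
    rewrite -!mulnA ltn_pmul2l // mulnC expnS expn1 mulnA ltn_mul2r ltnW //=.
    by apply: leq_trans lt_db _; rewrite leq_pmull.
  by rewrite ltr_pM2l.
rewrite !ltr_eXz2l // in lo hi; clear -lo hi; lia.
Qed.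

Lemma aligned_digitsP (d : 'I_b.+1) : reflect
  ((0 < d < b)%N /\
    exists2 e, (0 < e < b)%N & (r * d = s * e \/ r * d = s * e * b)%N)
  (d \in aligned_digits a b).
Proof.
have s0' : (s%:R : rat) != 0 by rewrite pnatr_eq0 -lt0n.
have b0' : (b%:R : rat) != 0 by rewrite pnatr_eq0 -lt0n ltnW.
have aE (e : nat) (j : int) : a * d%:R = e%:R * b%:R ^ j <->
    (r * d)%:R = (s * e)%:R * b%:R ^ (j - k) :> rat.
  rewrite /a expfzDr // -invr_expz !natrM.
  have B0 : (b%:R : rat) ^ k != 0 by rewrite expfz_neq0.
  split=> eq.
    have -> : r%:R * d%:R = r%:R / s%:R * b%:R ^ k * d%:R * s%:R / b%:R ^ k :> rat.
      by field; rewrite s0' B0.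
    by rewrite eq; field.
  have -> : r%:R / s%:R * b%:R ^ k * d%:R = r%:R * d%:R / s%:R * b%:R ^ k :> rat.
    by field.
  by rewrite eq; field; rewrite s0' B0.
rewrite !inE; apply: (iffP andP).
  move=> [db /asboolP[e [j [eb /aE eq]]]]; split=> //; exists e => //.
  have [j0|j1] := aligned_exponent db eb eq.
    left; apply/eqP; rewrite -(eqr_nat rat) eq j0 expr0z mulr1 //.
  by right; apply/eqP; rewrite -(eqr_nat rat) eq j1 expr1z -natrM.
move=> [db [e eb eq]]; split=> //; apply/asboolP.
case: eq => eq.
  exists e, k; split=> //; apply/aE.
  by rewrite subrr expr0z mulr1 eq.
exists e, (k + 1); split=> //; apply/aE.
by rewrite addrAC subrr add0r expr1z -natrM eq.
Qed.

Lemma leq_div_pred (m N q : nat) : (0 < q)%N -> (0 < N)%N ->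
  (m <= (N - 1) %/ q)%N = (m * q < N)%N.
Proof. by move=> q0 N0; rewrite leq_divRL //; lia. Qed.

(** With b = b' g and r = r' g, the equation r d = s e b becomes r' d = s e b',
    where r' is coprime to s and to b'; so e = n r' and d = n s b'.  Likewise
    r d = s e forces d = m s and e = m r, r being coprime to s. *)
Lemma card_aligned_digits :
  #|aligned_digits a b| = ((b - 1) %/ r + (gcdn b r - 1) %/ s)%N.
Proof.
have b0 : (0 < b)%N by apply: ltnW.
set g := gcdn b r; have g0 : (0 < g)%N by rewrite gcdn_gt0 b0.
have [b' bE] : exists b', b = (b' * g)%N by apply/dvdnP/dvdn_gcdl.
have [r' rE] : exists r', r = (r' * g)%N by apply/dvdnP/dvdn_gcdr.
have b'0 : (0 < b')%N by move: b0; rewrite bE muln_gt0 => /andP[].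
have r'0 : (0 < r')%N by move: r0; rewrite rE muln_gt0 => /andP[].
have cop_rb : coprime r' b'.
  by rewrite /coprime gcdnC -(eqn_pmul2r g0) mul1n muln_gcdl -bE -rE.
have cop_rs : coprime r' s by apply: coprime_dvdl cop; rewrite rE dvdn_mulr.
have sb0 : (0 < s * b')%N by rewrite muln_gt0 s0.
pose low := [set d : 'I_b.+1 |
  [&& (0 < d)%N, (s %| d)%N & (d <= s * ((b - 1) %/ r))%N]].
pose high := [set d : 'I_b.+1 |
  [&& (0 < d)%N, (s * b' %| d)%N & (d <= s * b' * ((g - 1) %/ s))%N]].
have lowP (d : 'I_b.+1) : d \in low <->
    [/\ (0 < d < b)%N & exists2 e, (0 < e < b)%N & (r * d = s * e)%N].
  rewrite inE; split.
    move=> /and3P[d0 /dvdnP[m dE]].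
    rewrite dE mulnC leq_pmul2l // leq_div_pred // => mr.
    rewrite dE in d0.
    have m0 : (0 < m)%N by move: d0; rewrite muln_gt0 => /andP[].
    split; first by rewrite mulnC d0 /=; clear -mr ltsr; nia.
    exists (m * r)%N; first by rewrite mr muln_gt0 m0 r0.
    by clear; nia.
  move=> [/andP[d0 db] [e /andP[e0 eb] eq]].
  have /dvdnP[m dE] : (s %| d)%N.
    by rewrite -(Gauss_dvdr d (n := r)) ?eq ?dvdn_mulr // coprime_sym.
  rewrite d0 dE dvdn_mull //= mulnC leq_pmul2l // leq_div_pred //.
  by move: eq eb; rewrite dE; clear -s0; nia.
(* The bound s m < g is equivalent to d < b; the bound e < b then follows from r < s b. *)
have highP (d : 'I_b.+1) : d \in high <->
    [/\ (0 < d < b)%N & exists2 e, (0 < e < b)%N & (r * d = s * e * b)%N].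
  rewrite inE; split.
    move=> /and3P[d0 /dvdnP[m dE]].
    rewrite dE mulnC (leq_pmul2l sb0) leq_div_pred // => mg.
    rewrite dE in d0.
    have m0 : (0 < m)%N by move: d0; rewrite muln_gt0 => /andP[].
    have db : (m * (s * b') < b)%N.
      by rewrite bE mulnA [X in (_ < X)%N]mulnC ltn_pmul2r.
    split; first by rewrite [(s * b' * m)%N]mulnC d0 db.
    have eq : (r * (s * b' * m) = s * (m * r') * b)%N.
      by rewrite [X in (X * _)%N]rE [X in _ = (_ * X)%N]bE; clear; nia.
    exists (m * r')%N => //; rewrite muln_gt0 m0 r'0 /=.
    apply: ltn_trans db; rewrite -(@ltn_pmul2l (s * b)) ?muln_gt0 ?s0 //.
    rewrite mulnAC -eq [(m * _)%N]mulnC ltn_pmul2r //.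
    by rewrite mulnC.
  move=> [/andP[d0 db] [e /andP[e0 eb] eq]].
  have eq' : (r' * d = s * e * b')%N.
    apply/eqP; rewrite -(eqn_pmul2r g0) mulnAC -rE eq.
    by rewrite -[X in _ == X]mulnA -bE.
  have /dvdnP[n eE] : (r' %| e)%N.
    have : (r' %| s * e * b')%N by rewrite -eq' dvdn_mulr.
    by rewrite Gauss_dvdl // Gauss_dvdr.
  have dE : d = (n * (s * b'))%N :> nat.
    by apply/eqP; rewrite -(eqn_pmul2l r'0) eq' eE; apply/eqP; clear; nia.
  rewrite d0 dE dvdn_mull //= mulnC (leq_pmul2l sb0) leq_div_pred //.
  by move: db; rewrite dE bE mulnA [X in (_ < X)%N]mulnC ltn_pmul2r.
have -> : aligned_digits a b = low :|: high.
  apply/setP => d; apply/aligned_digitsP/setUP.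
    move=> [db [e eb [eq|eq]]]; [left; apply/lowP|right; apply/highP];
      by split=> //; exists e.
  by move=> [/lowP|/highP] [db [e eb eq]]; split=> //; exists e => //; [left|right].
have disj : [disjoint low & high].
  apply/pred0P => d /=; apply/andP => -[/lowP[db [e eb eq]]].
  move=> /highP[_ [f fb eq']].
  have : (s * e < s * (f * b))%N.
    rewrite ltn_pmul2l //; case/andP: eb => _ /leq_trans; apply.
    by rewrite leq_pmull //; case/andP: fb.
  by rewrite mulnA -eq -eq' ltnn.
rewrite cardsU (disjoint_setI0 disj) cards0 subn0 !card_multiples //.
- rewrite ltnS mulnAC [X in (_ <= X)%N]bE mulnC leq_pmul2l //.
  by rewrite mulnC (leq_trans (leq_trunc_div _ _)) ?leq_subr.
- rewrite ltnS; apply: leq_trans (_ : r * ((b - 1) %/ r) <= _)%N.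
    by rewrite leq_mul2r ltnW ?orbT.
  by rewrite mulnC (leq_trans (leq_trunc_div _ _)) ?leq_subr.
Qed.
End Count.

(** * Reduced forms *)

(** Both exponents are the integer part of the logarithm of a in base b. *)
Lemma reduced_form_uniq (a : rat) (b r s r' s' : nat) :
  reduced_form a b r s -> reduced_form a b r' s' -> (r, s) = (r', s').
Proof.
move=> [[_ s0 cop] gt1 ltb [k ak]] [[_ s'0 cop'] gt1' ltb' [k' ak']].
have b1 : 1 < b%:R :> rat := lt_trans gt1 ltb.
have b0 : 0 < b%:R :> rat := lt_trans ltr01 b1.
have scale_itv (x : rat) (l : int) : 1 < x -> x < b%:R ->
    b%:R ^ l <= x * b%:R ^ l < b%:R ^ (l + 1).
  move=> x1 xb; rewrite expfzDr ?gt_eqF // expr1z [b%:R ^ l * _]mulrC.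
  by rewrite ltr_pM2r ?exprz_gt0 // xb andbT ler_peMl ?exprz_ge0 // ltW.
have k_itv := scale_itv _ k gt1 ltb; have k'_itv := scale_itv _ k' gt1' ltb'.
rewrite -ak in k_itv; rewrite -ak' in k'_itv.
have eqk := exprz_itv_uniq b1 k_itv k'_itv.
apply: coprime_fraction_inj => //; apply: (mulIf (expfz_neq0 k (lt0r_neq0 b0))).
by rewrite -ak {1}eqk.
Qed.

Lemma reduced_form_exists (a : rat) (b : nat) :
  (1 < b)%N -> 0 < a -> (forall h : int, a <> b%:R ^ h) ->
  exists r s, reduced_form a b r s.
Proof.
move=> b1 a0 not_pow; have b1' : 1 < b%:R :> rat by rewrite ltr1n.
have b0 : 0 < b%:R :> rat := lt_trans ltr01 b1'.
have [k /andP[lek ltk]] := exprz_itv b1' a0.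
have bk0 : 0 < b%:R ^ k :> rat by rewrite exprz_gt0.
have [r [s [r0 s0 cop eq]]] := pos_rat_fraction (divr_gt0 a0 bk0).
exists r, s; split=> //; rewrite -?eq.
- rewrite ltr_pdivlMr // mul1r lt_neqAle lek andbT.
  by apply/eqP => /esym; apply: not_pow.
- by rewrite ltr_pdivrMr // -[X in X * _]expr1z -expfzDr ?gt_eqF // addrC.
- by exists k; rewrite divfK // gt_eqF.
Qed.

Unset Implicit Arguments.
Set Strict Implicit.

Theorem corollary7p4 (a : rat) (b : nat) (hab : admissible a b) :
  (exists! rs : nat * nat, reduced_form a b rs.1 rs.2) /\
  (forall r s : nat, reduced_form a b r s ->
     seq_cyclomatic_complexity (leading_digit_seq a b) =
     b%:Z - ((b - 1) %/ r)%N%:Z - ((gcdn b r - 1) %/ s)%N%:Z).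
Proof.
have [sqf b5 a0 not_pow] := hab.
have b1 : (1 < b)%N := leq_trans (isT : 1 < 5)%N b5.
split.
  have [r [s rs]] := reduced_form_exists b1 a0 not_pow.
  exists (r, s); split=> // -[r' s'] rs'.
  exact: reduced_form_uniq rs rs'.
move=> r s [[r0 s0 cop] gt1 ltb [k ak]].
have s0' : 0 < s%:R :> rat by rewrite ltr0n.
have ltsr : (s < r)%N by move: gt1; rewrite ltr_pdivlMr // mul1r ltr_nat.
have ltrb : (r < s * b)%N.
  by move: ltb; rewrite ltr_pdivrMr // -natrM ltr_nat mulnC.
rewrite leading_digit_seq_cyclomatic //; first last.
- exact: squarefree_independent.
- exact: leq_trans b5.
by rewrite ak card_aligned_digits // PoszD opprD addrA.
Qed.
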